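(* Let $n, m, k$ be positive integers, let $f : \mathbb{B}^n \to \mathbb{B}^m$ and $g : \mathbb{B}^m \to \mathbb{B}^k$ be Boolean functions, and let $\phi, \gamma \in G(\mathbb{B}^{n+m+k})$ be given by $\phi(x,y,z) = (x, y \oplus f(x), z)$ and $\gamma(x,y,z) = (x, y, z \oplus g(y))$ for $x \in \mathbb{B}^n$, $y \in \mathbb{B}^m$, $z \in \mathbb{B}^k$. Then the subgroup $$G_{2s} = \{e, \phi, \gamma, \phi \circ \gamma, (\phi \circ \gamma)^2, (\phi \circ \gamma)^3, \phi \circ (\gamma \circ \phi), \gamma \circ (\phi \circ \gamma)\}$$ of $G(\mathbb{B}^{n+m+k})$ generated by $\phi$ and $\gamma$ is isomorphic to the dihedral group $D_8$ of order $8$.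
   Context: $\mathbb{B} = \{0,1\}$, and $\oplus$ denotes (componentwise) Boolean exclusive-or. $G(\mathbb{B}^p)$ is the group, under functional composition, of invertible functions $\mathbb{B}^p \to \mathbb{B}^p$, and $e$ is its identity. Elements of $\mathbb{B}^{n+m+k}$ are written $(x,y,z)$ with $x\in\mathbb{B}^n$, $y\in\mathbb{B}^m$, $z\in\mathbb{B}^k$. The dihedral group $D_8$ is the 8-element group $\{e, A, A^2, A^3, B, AB, A^2B, A^3B\}$ with $A^4 = B^2 = (AB)^2 = e$.
   Formalization: The isomorphism with D_8 is proved only when g(y ⊕ f(x)) ≠ g(y) for some x, y; otherwise (e.g. f constantly 0) φ and γ commute and the claim is false. That the listed set is the generated subgroup holds for all f, g. *)

(* Defs.v *)
From mathcomp Require Import all_boot all_algebra all_fingroup all_solvable.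

Set Implicit Arguments.
Unset Strict Implicit.
Unset Printing Implicit Defensive.

Notation "''B_' p" := 'rV[bool]_p (at level 0, p at level 2) : type_scope.

Definition xorv (p : nat) (u v : 'B_p) : 'B_p := map2_mx addb u v.

Notation "u ⊕ v" := (xorv u v) (at level 50, left associativity).

Definition triple (n m k : nat) (x : 'B_n) (y : 'B_m) (z : 'B_k) :
    'B_(n + m + k) :=
  row_mx (row_mx x y) z.

Definition xpart (n m k : nat) (v : 'B_(n + m + k)) : 'B_n :=
  lsubmx (lsubmx v).
Definition ypart (n m k : nat) (v : 'B_(n + m + k)) : 'B_m :=
  rsubmx (lsubmx v).
Definition zpart (n m k : nat) (v : 'B_(n + m + k)) : 'B_k :=
  rsubmx v.

Lemma xpart_triple n m k (x : 'B_n) (y : 'B_m) (z : 'B_k) :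
  xpart (triple x y z) = x.
Proof. by rewrite /xpart /triple !row_mxKl. Qed.

Lemma ypart_triple n m k (x : 'B_n) (y : 'B_m) (z : 'B_k) :
  ypart (triple x y z) = y.
Proof. by rewrite /ypart /triple row_mxKl row_mxKr. Qed.

Lemma zpart_triple n m k (x : 'B_n) (y : 'B_m) (z : 'B_k) :
  zpart (triple x y z) = z.
Proof. by rewrite /zpart /triple row_mxKr. Qed.

Definition tripleE := (xpart_triple, ypart_triple, zpart_triple).

Lemma triple_parts n m k (v : 'B_(n + m + k)) :
  triple (xpart v) (ypart v) (zpart v) = v.
Proof. by rewrite /triple !hsubmxK. Qed.

Lemma xorvK p (u v : 'B_p) : u ⊕ v ⊕ v = u.
Proof. by apply/matrixP=> i j; rewrite !mxE addbK. Qed.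

Definition phi_fun (n m k : nat) (f : 'B_n -> 'B_m) (v : 'B_(n + m + k)) :=
  triple (xpart v) (ypart v ⊕ f (xpart v)) (zpart v).

Definition gamma_fun (n m k : nat) (g : 'B_m -> 'B_k) (v : 'B_(n + m + k)) :=
  triple (xpart v) (ypart v) (zpart v ⊕ g (ypart v)).

Lemma phi_funK n m k (f : 'B_n -> 'B_m) :
  involutive (@phi_fun n m k f).
Proof. by move=> v; rewrite /phi_fun !tripleE xorvK triple_parts. Qed.

Lemma gamma_funK n m k (g : 'B_m -> 'B_k) :
  involutive (@gamma_fun n m k g).
Proof. by move=> v; rewrite /gamma_fun !tripleE xorvK triple_parts. Qed.

(* The group of invertible functions on 'B_p is {perm 'B_p}. *)
Definition phi_perm (n m k : nat) (f : 'B_n -> 'B_m) :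
    {perm 'B_(n + m + k)} :=
  perm (inv_inj (@phi_funK n m k f)).

Definition gamma_perm (n m k : nat) (g : 'B_m -> 'B_k) :
    {perm 'B_(n + m + k)} :=
  perm (inv_inj (@gamma_funK n m k g)).

Lemma phi_permE n m k (f : 'B_n -> 'B_m) x y (z : 'B_k) :
  phi_perm k f (triple x y z) = triple x (y ⊕ f x) z.
Proof. by rewrite permE /phi_fun !tripleE. Qed.

Lemma gamma_permE n m k (g : 'B_m -> 'B_k) (x : 'B_n) y z :
  gamma_perm n g (triple x y z) = triple x y (z ⊕ g y).
Proof. by rewrite permE /gamma_fun !tripleE. Qed.

(* The product s * t of {perm T} applies s first, so s ∘ t is t * s. *)
Definition pcomp (T : finType) (s t : {perm T}) : {perm T} := (t * s)%g.

Notation "s ∘ t" := (pcomp s t) (at level 40, left associativity).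

Lemma pcompE (T : finType) (s t : {perm T}) (v : T) : (s ∘ t) v = s (t v).
Proof. exact: permM. Qed.

(* Main.v *)
(** Both [phi] and [gamma] are involutions, so they generate a dihedral group
    whose rotations are the powers of [a = phi ∘ gamma].  The square of [a]
    fixes [x] and [y] and adds to [z] a vector depending only on [x] and [y],
    so [a ^+ 4 = 1]; and [a ^+ 2 != 1] exactly when [g (y ⊕ f x) <> g y] for
    some [x] and [y]. *)
Require Import Defs.
From mathcomp Require Import all_boot all_algebra all_fingroup all_solvable.

Set Implicit Arguments.
Unset Strict Implicit.
Unset Printing Implicit Defensive.

Local Open Scope group_scope.

Lemma xorvC p (u v : 'B_p) : u ⊕ v = v ⊕ u.
Proof. by apply/matrixP=> i j; rewrite !mxE addbC. Qed.

Lemma xorvA p (u v w : 'B_p) : u ⊕ (v ⊕ w) = u ⊕ v ⊕ w.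
Proof. by apply/matrixP=> i j; rewrite !mxE addbA. Qed.

Lemma xorKv p (u v : 'B_p) : u ⊕ (u ⊕ v) = v.
Proof. by rewrite xorvC (xorvC u) xorvK. Qed.

Section InvolutionPair.

Variables (gT : finGroupType) (p q : gT).
Hypotheses (p2 : p * p = 1) (q2 : q * q = 1).

Lemma conj_mul_involutions : (q * p) ^ p = (q * p)^-1.
Proof.
have pV : p^-1 = p by apply: (mulgI p); rewrite mulgV p2.
have qV : q^-1 = q by apply: (mulgI q); rewrite mulgV q2.
by rewrite conjgE invMg pV qV -!mulgA p2 mulg1.
Qed.

(** Conjugation by [p] inverts [q * p], so [p] normalizes the rotations and the join is a plain
    product. *)
Lemma gen_involutions_mul : <<[set p; q]>> = <[q * p]> * <[p]>.
Proof.
set a := q * p.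
have nap : <[p]> \subset 'N(<[a]>).
  rewrite cycle_subG; apply/normP.
  by rewrite -cycleJ conj_mul_involutions cycleV.
rewrite -(norm_joinEr nap); apply/eqP; rewrite eqEsubset.
rewrite gen_subG subUset !sub1set (join_subG <[a]>%G) !cycle_subG.
have Jp : p \in <[a]> <*> <[p]> by rewrite mem_gen // inE cycle_id orbT.
have Ja : a \in <[a]> <*> <[p]> by rewrite mem_gen // inE cycle_id.
by rewrite Jp -(groupMr q Jp) Ja groupM ?mem_gen ?set21 ?set22.
Qed.

(** Every element is [a ^+ i * p ^+ j] with [i < 4] and [j < 2]. The eight listed terms may
    coincide. *)
Lemma gen_involutions_set : (q * p) ^+ 4 = 1 ->
  <<[set p; q]>> = [set 1; p; q; q * p; (q * p) ^+ 2; (q * p) ^+ 3;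
                        p * q * p; q * p * q].
Proof.
move=> a4; set a := q * p.
have Gp : p \in <<[set p; q]>> by rewrite mem_gen ?set21.
have Gq : q \in <<[set p; q]>> by rewrite mem_gen ?set22.
apply/eqP; rewrite eqEsubset; apply/andP; split; last first.
  by rewrite !subUset !sub1set ?group1 ?groupX ?groupM ?Gp ?Gq.
rewrite gen_involutions_mul.
apply/subsetP=> _ /mulsgP[_ _ /cycleP[i ->] /cycleP[j ->] ->].
have ap : a * p = q by rewrite /a -mulgA p2 mulg1.
have a2p : a ^+ 2 * p = q * p * q by rewrite expgS expg1 -mulgA ap.
have a3p : a ^+ 3 * p = p * q * p.
  suff -> : a ^+ 3 = p * q by [].
  by apply: (mulgI a); rewrite -expgS a4 mulgA ap q2.
rewrite -(expg_mod j (p2 : p ^+ 2 = 1)) -(expg_mod i a4).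
have := ltn_pmod i (isT : 0 < 4)%N; have := ltn_pmod j (isT : 0 < 2)%N.
case: (j %% 2)%N => [|[|//]] _; case: (i %% 4)%N => [|[|[|[|//]]]] _;
  by rewrite ?expg0 ?expg1 ?mul1g ?mulg1 ?ap ?a2p ?a3p !inE eqxx ?orbT.
Qed.

Lemma gen_involutions_D8 : (q * p) ^+ 4 = 1 -> (q * p) ^+ 2 != 1 ->
  <<[set p; q]>> \isog 'D_8.
Proof.
move=> a4 a2; set a := q * p.
have ord2 (u : gT) : u * u = 1 -> u != 1 -> #[u] = 2.
  by move=> u2; apply: nt_prime_order.
have pNa : p \notin <[a]>.
  (* A power of [a] commutes with [a], so conjugation by [p] would both fix and invert [a]. *)
  apply: contra a2 => /cycleP[i def_p].
  have := conj_mul_involutions; rewrite conjgE -/a.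
  have /commgP/conjg_fixP : commute a p by rewrite def_p; apply: commuteX.
  by rewrite conjgE => -> aV; rewrite expgS expg1 {2}aV mulgV.
have pN1 : p != 1 by apply: contraNneq pNa => ->; apply: group1.
have neq_pq : p != q.
  by apply: contraNneq a2 => e; rewrite -e p2 expg1n.
have qN1 : q != 1.
  by apply: contraNneq pNa => e; rewrite /a e mul1g cycle_id.
have op := ord2 _ p2 pN1; have oq := ord2 _ q2 qN1.
have oa : #[a] = 4.
  by apply: (@orderXprime _ 2 2) => //; apply: ord2; rewrite -?expgD.
have := involutions_gen_dihedral op oq neq_pq.
(* The dihedral index is the group order, here 4 * 2: [<[p]>] has prime order and is not inside
   [<[a]>], so they meet trivially. *)
rewrite /= gen_involutions_mul TI_cardMg -?orderE ?oa ?op //.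
by rewrite setIC prime_TIg -?orderE ?op ?cycle_subG.
Qed.

End InvolutionPair.

(** The isomorphism is conditional because degenerate pairs collapse: for [f = 0], [phi] is the
    identity and the group has at most two elements. *)
Theorem lemma11 (n m k : nat) (n_gt0 : (0 < n)%N) (m_gt0 : (0 < m)%N)
    (k_gt0 : (0 < k)%N) (f : 'B_n -> 'B_m) (g : 'B_m -> 'B_k) :
  let phi := phi_perm k f in
  let gamma := gamma_perm n g in
  let G2s := <<[set phi; gamma]>> in
  G2s = [set 1; phi; gamma; phi ∘ gamma;
             (phi ∘ gamma) ^+ 2; (phi ∘ gamma) ^+ 3;
             phi ∘ (gamma ∘ phi); gamma ∘ (phi ∘ gamma)]
  /\ ((exists (x : 'B_n) (y : 'B_m), g (y ⊕ f x) <> g y) ->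
      G2s \isog 'D_8).
Proof.
move=> phi gamma G2s.
have phi2 : phi * phi = 1.
  by apply/permP=> v; rewrite permM perm1 !permE phi_funK.
have gamma2 : gamma * gamma = 1.
  by apply/permP=> v; rewrite permM perm1 !permE gamma_funK.
have rot2E x y z : ((gamma * phi) ^+ 2) (triple x y z)
    = triple x y (z ⊕ (g y ⊕ g (y ⊕ f x))).
  by rewrite expgS expg1 !permM !(gamma_permE, phi_permE) xorvK xorvA.
have rot4 : (gamma * phi) ^+ 4 = 1.
  apply/permP=> v; rewrite -(triple_parts v) perm1.
  by rewrite (expgM _ 2 2) [_ ^+ 2]expgS expg1 permM !rot2E xorvK.
(* Unfolding [∘] reverses each product, so the two lists agree by conversion. *)
split; first exact: gen_involutions_set.
move=> [x [y gN]]; apply: gen_involutions_D8 => //.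
(* Taking [z = g y] cancels one summand, leaving [g (y ⊕ f x)] as the last component of the
   image. *)
apply/eqP=> rot2; apply: gN; have := rot2E x y (g y).
rewrite rot2 perm1 => /(congr1 (@zpart n m k)).
by rewrite !tripleE xorKv => <-.
Qed.
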